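(* Artin's braid group $B_\infty$ on infinitely many strands, with the topology described in the context, is topologically incomplete: there is no complete metric on $B_\infty$ inducing its topology.
   Context: $B_\infty$ is the direct limit of Artin's braid groups $B_n$ on $n$ strands under the monomorphisms $B_n\to B_{n+1}$ that attach a trivial $(n+1)$-st strand. It is made into a topological group by requiring that a sequence $b_n\to \mathrm{id}$ in $B_\infty$ if and only if for each $M$ there exists $N$ such that for all $n\ge N$ the first $M$ strands of $b_n$ are trivial. Here ''the first $M$ strands of $b$ are trivial'' means that for each $i\le M$ the strand of $b$ starting at position $i$ ends at position $i$, and that the $M$-strand braid obtained from $b$ by deleting all other strands is the trivial element of $B_M$. Equivalently, the sets $U_M=\{b\in B_\infty:\text{the first } M \text{ strands of } b \text{ are trivial}\}$, $M\ge1$, form a neighborhood basis at the identity of this group topology. *)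

(* Defs.v *)
From HB Require Import structures.
From mathcomp Require Import all_boot all_order all_algebra generic_quotient.
From mathcomp Require Import zify.
From mathcomp Require Import boolp classical_sets reals topology.

Set Implicit Arguments.
Unset Strict Implicit.
Unset Printing Implicit Defensive.

Local Open Scope quotient_scope.

(* Strands and positions are numbered from 0. The letter (i, true) is the     *)
(* Artin generator sigma_i, which exchanges the strands in positions i and    *)
(* i.+1, and (i, false) is its inverse; braid words are read left to right.   *)
Definition word := seq (nat * bool).

Definition nstrand (n : nat) : pred word := all (fun l => l.1.+1 < n).

(* Restricted to n-strand words, this is equality in B_n: the relation         *)
(* generated by Artin's relations and by free cancellation.                   *)
Inductive artin (n : nat) : word -> word -> Prop :=
| artin_free u v i e : i.+1 < n ->
    artin n (u ++ [:: (i, e); (i, ~~ e)] ++ v) (u ++ v)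
| artin_far u v i j : i.+1 < j -> j.+1 < n ->
    artin n (u ++ [:: (i, true); (j, true)] ++ v)
            (u ++ [:: (j, true); (i, true)] ++ v)
| artin_braid u v i : i.+2 < n ->
    artin n (u ++ [:: (i, true); (i.+1, true); (i, true)] ++ v)
            (u ++ [:: (i.+1, true); (i, true); (i.+1, true)] ++ v)
| artin_refl u : artin n u u
| artin_sym u v : artin n u v -> artin n v u
| artin_trans v u w : artin n u v -> artin n v w -> artin n u w.

Definition winv (w : word) : word := rev [seq (l.1, ~~ l.2) | l <- w].

Lemma artin_ctx n a b u v : artin n u v -> artin n (a ++ u ++ b) (a ++ v ++ b).
Proof.
elim=> {u v} [u v i e h|u v i j h h'|u v i h|u|u v _ IH|v u w _ IH1 _ IH2].
- by have := artin_free (a ++ u) (v ++ b) e h; rewrite -!catA.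
- by have := artin_far (a ++ u) (v ++ b) h h'; rewrite -!catA.
- by have := artin_braid (a ++ u) (v ++ b) h; rewrite -!catA.
- exact: artin_refl.
- exact: artin_sym.
- exact: artin_trans IH1 IH2.
Qed.

Lemma artin_cat n u u' v v' :
  artin n u u' -> artin n v v' -> artin n (u ++ v) (u' ++ v').
Proof.
move=> /(artin_ctx [::] v) /= huv /(artin_ctx u' [::]).
by rewrite !cats0; apply: artin_trans.
Qed.

Lemma artin_widen n m u v : n <= m -> artin n u v -> artin m u v.
Proof.
move=> nm; elim=> {u v} [u v i e h|u v i j h h'|u v i h|u|u v _ IH|v u w _ IH1 _ IH2].
- by apply: artin_free; lia.
- by apply: artin_far; lia.
- by apply: artin_braid; lia.
- exact: artin_refl.
- exact: artin_sym.
- exact: artin_trans IH1 IH2.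
Qed.

Lemma winvK : involutive winv.
Proof.
move=> w; rewrite /winv map_rev revK -map_comp map_id_in// => -[i e] _ /=.
by rewrite negbK.
Qed.

Lemma nstrand_winv n w : nstrand n (winv w) = nstrand n w.
Proof. by rewrite /nstrand /winv all_rev all_map. Qed.

Lemma nstrand_widen n m w : n <= m -> nstrand n w -> nstrand m w.
Proof. by move=> nm; apply: sub_all => l /=; lia. Qed.

Lemma artin_mulV n w : nstrand n w -> artin n (w ++ winv w) [::].
Proof.
elim: w => [_|[i e] w IH /=/andP[h /IH{}IH]]; first exact: artin_refl.
rewrite /winv /= rev_cons -cats1 catA.
apply: artin_trans (artin_free [::] [::] e h).
by rewrite -cat1s catA -[in X in artin _ X]catA; apply: (artin_ctx [:: _] [:: _] IH).
Qed.

Lemma artin_Vmul n w : nstrand n w -> artin n (winv w ++ w) [::].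
Proof.
by rewrite -{1}[w]winvK nstrand_winv => /artin_mulV; rewrite winvK.
Qed.

Lemma artin_winv n u v : nstrand n u -> nstrand n v ->
  artin n u v -> artin n (winv u) (winv v).
Proof.
move=> hu hv huv.
apply: (@artin_trans _ (winv u ++ v ++ winv v)).
  rewrite -{1}[winv u]cats0; apply: artin_cat; first exact: artin_refl.
  exact/artin_sym/artin_mulV.
apply: (@artin_trans _ (winv u ++ u ++ winv v)).
  exact/artin_ctx/artin_sym.
rewrite catA -{2}[winv v]cat0s; apply: artin_cat; last exact: artin_refl.
exact: artin_Vmul.
Qed.

Section Braid.
Variable n : nat.

Definition bword := {w : word | nstrand n w}.

Definition bartin (u v : bword) := `[< artin n (val u) (val v) >].

Lemma bartin_equiv : equiv_class_of bartin.
Proof.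
split=> [u|u v|v u w].
- exact/asboolP/artin_refl.
- by apply/asboolP/asboolP; apply: artin_sym.
- by move=> /asboolP uv /asboolP vw; apply/asboolP/(artin_trans uv vw).
Qed.

Canonical bartin_equivRel := EquivRelPack bartin_equiv.

(* Artin's braid group B_n *)
Definition braid := {eq_quot bartin}.
HB.instance Definition _ : EqQuotient _ bartin braid := EqQuotient.on braid.
HB.instance Definition _ := Choice.on braid.

Definition bclass (w : bword) : braid := \pi_braid w.

Lemma bclassP u v : bclass u = bclass v <-> artin n (val u) (val v).
Proof. by split=> [/eqquotP/asboolP|h]//; apply/eqquotP/asboolP. Qed.

Lemma bclass_repr a : bclass (repr a) = a. Proof. exact: reprK. Qed.

Lemma repr_bclass u : artin n (val (repr (bclass u))) (val u).
Proof. by apply/bclassP; rewrite bclass_repr. Qed.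

Lemma nstrand_cat (u v : bword) : nstrand n (val u ++ val v).
Proof. by rewrite /nstrand all_cat; apply/andP; split; apply: valP. Qed.

Definition bone : braid := bclass (Sub [::] isT).
Definition bmul (a b : braid) : braid :=
  bclass (Sub _ (nstrand_cat (repr a) (repr b))).

Lemma nstrand_inv (u : bword) : nstrand n (winv (val u)).
Proof. by rewrite nstrand_winv; apply: valP. Qed.

Definition binv (a : braid) : braid := bclass (Sub _ (nstrand_inv (repr a))).

Lemma bmulA : associative bmul.
Proof.
move=> a b c; apply/bclassP => /=; apply: artin_trans.
  by apply: artin_cat; [exact: artin_refl|exact: repr_bclass].
rewrite SubK catA; apply: artin_cat; last exact: artin_refl.
exact/artin_sym/repr_bclass.
Qed.

Lemma bmul1 : left_id bone bmul.
Proof.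
move=> a; rewrite -{2}[a]bclass_repr; apply/bclassP => /=.
by rewrite -{2}[val (repr a)]cat0s; apply: artin_cat;
  [exact: repr_bclass|exact: artin_refl].
Qed.

Lemma b1mul : right_id bone bmul.
Proof.
move=> a; rewrite -{2}[a]bclass_repr; apply/bclassP => /=.
by rewrite -{2}[val (repr a)]cats0; apply: artin_cat;
  [exact: artin_refl|exact: repr_bclass].
Qed.

Lemma bVmul : left_inverse bone binv bmul.
Proof.
move=> a; apply/bclassP => /=; apply: artin_trans (artin_Vmul (valP (repr a))).
by apply: artin_cat; [exact: repr_bclass|exact: artin_refl].
Qed.

Lemma bmulV : right_inverse bone binv bmul.
Proof.
move=> a; apply/bclassP => /=; apply: artin_trans (artin_mulV (valP (repr a))).
by apply: artin_cat; [exact: artin_refl|exact: repr_bclass].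
Qed.

HB.instance Definition _ := isGroup.Build braid bmulA bmul1 b1mul bVmul bmulV.

Lemma bclassM (u v : bword) h :
  bclass (Sub (val u ++ val v) h) = (bclass u * bclass v)%g.
Proof.
by apply/bclassP => /=; apply: artin_cat; apply/artin_sym/repr_bclass.
Qed.

Lemma bclassV (u : bword) h : bclass (Sub (winv (val u)) h) = ((bclass u)^-1)%g.
Proof.
apply/bclassP => /=; apply: artin_winv; rewrite ?(valP _)//.
exact/artin_sym/repr_bclass.
Qed.

End Braid.

Definition bword_widen n m (nm : n <= m) (w : bword n) : bword m :=
  Sub (val w) (nstrand_widen nm (valP w)).

(* B_n -> B_m, attaching m - n trivial strands on the right; a monomorphism   *)
(* by widenM and widen_inj                                                    *)
Definition widen n m (nm : n <= m) (a : braid n) : braid m :=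
  bclass (bword_widen nm (repr a)).

Lemma widen_bclass n m (nm : n <= m) (w : bword n) :
  widen nm (bclass w) = bclass (bword_widen nm w).
Proof. exact/bclassP/(artin_widen nm)/repr_bclass. Qed.

Lemma widenM n m (nm : n <= m) a b :
  widen nm (a * b)%g = (widen nm a * widen nm b)%g.
Proof.
rewrite -[a]bclass_repr -[b]bclass_repr -bclassM ?nstrand_cat// => h.
rewrite !widen_bclass -bclassM; first by rewrite nstrand_cat.
by move=> h'; apply/bclassP/artin_refl.
Qed.

Lemma widen_comp n m k (nm : n <= m) (mk : m <= k) (nk : n <= k) a :
  widen mk (widen nm a) = widen nk a.
Proof.
by rewrite -[a]bclass_repr !widen_bclass; apply/bclassP/artin_refl.
Qed.

Definition transp (i k : nat) : nat :=
  if k == i then i.+1 else if k == i.+1 then i else k.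

(* final position of the strand starting at position k *)
Definition strand_end (w : word) (k : nat) : nat :=
  foldl (fun p l => transp l.1 p) k w.

Definition rank (S : pred nat) (i : nat) : nat := count S (iota 0 i).

(* S is the set of positions currently occupied by the strands that are kept; *)
(* a crossing survives iff both of its strands are kept, and is renumbered by *)
(* the number of kept strands to its left.                                    *)
Fixpoint delete (S : pred nat) (w : word) : word :=
  if w is (i, e) :: w' then
    (if S i && S i.+1 then [:: (rank S i, e)] else [::])
      ++ delete (S \o transp i) w'
  else [::].

(* positions, after w, of the strands starting at the positions in S *)
Definition track (S : pred nat) (w : word) : pred nat :=
  foldl (fun S l => S \o transp l.1) S w.

Ltac transp_tac := rewrite /transp; repeat case: eqP => //=; lia.

Lemma transpK i : involutive (transp i).
Proof. by move=> k; transp_tac. Qed.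

Lemma rankS S i : rank S i.+1 = rank S i + S i.
Proof. by rewrite /rank -addn1 iotaD count_cat /= add0n addn0. Qed.

Lemma rank_transp_lo S i k : k <= i -> rank (S \o transp i) k = rank S k.
Proof.
move=> ki; apply: eq_in_count => j; rewrite mem_iota /= => jk.
by congr S; transp_tac.
Qed.

Lemma rank_transp_hi S i k : i.+1 < k -> rank (S \o transp i) k = rank S k.
Proof.
elim: k => // k IH; rewrite ltnS leq_eqVlt => /orP[/eqP <-|ik].
  rewrite !rankS rank_transp_lo//= -!addnA; congr (_ + _).
  have -> : transp i i = i.+1 by transp_tac.
  by rewrite addnC; congr (_ + _); congr (nat_of_bool (S _)); transp_tac.
rewrite !rankS IH//=; congr (_ + nat_of_bool (S _)); transp_tac.
Qed.

Lemma rank_mono S i j : i <= j -> rank S i <= rank S j.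
Proof. by move=> /subnKC <-; rewrite /rank iotaD count_cat leq_addr. Qed.

Lemma delete_cat S u v : delete S (u ++ v) = delete S u ++ delete (track S u) v.
Proof. by elim: u S => //= -[i e] u IH S; rewrite IH catA. Qed.

Lemma track_cat S u v : track S (u ++ v) = track (track S u) v.
Proof. exact: foldl_cat. Qed.

Lemma strand_end_cat u v k :
  strand_end (u ++ v) k = strand_end v (strand_end u k).
Proof. exact: foldl_cat. Qed.

Lemma rank_track S n w : nstrand n w -> rank (track S w) n = rank S n.
Proof.
elim: w S => //= -[i e] w IH S /andP[/= h hw].
by rewrite IH// rank_transp_hi.
Qed.

Lemma nstrand_delete S n M w : nstrand n w -> rank S n = M ->
  nstrand M (delete S w).
Proof.
elim: w S => //= -[i e] w IH S /andP[/= h hw] hS.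
rewrite /nstrand all_cat; apply/andP; split; last first.
  by apply: IH => //; rewrite rank_transp_hi.
case: ifP => //= /andP[Si SSi]; rewrite andbT.
have := @rank_mono S _ _ h; rewrite !rankS Si SSi; lia.
Qed.

Lemma strand_end_artin n u v k : artin n u v -> strand_end u k = strand_end v k.
Proof.
move=> h; elim: h k => {u v} [u v i e h|u v i j h h'|u v i h|u|u v _ IH|v u w _ IH1 _ IH2] k //.
- by rewrite !strand_end_cat /= transpK.
- rewrite !strand_end_cat /=; congr (strand_end v); transp_tac.
- rewrite !strand_end_cat /=; congr (strand_end v); transp_tac.
- by rewrite IH1.
Qed.

Lemma track_artin n u v S : artin n u v -> track S u = track S v.
Proof.
move=> h; elim: h S => {u v} [u v i e h|u v i j h h'|u v i h|u|u v _ IH|v u w _ IH1 _ IH2] S //.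
- rewrite !track_cat /=; congr (track _ v); apply: funext => k /=.
  by rewrite transpK.
- rewrite !track_cat /=; congr (track _ v); apply: funext => k /=.
  by congr (track S u); transp_tac.
- rewrite !track_cat /=; congr (track _ v); apply: funext => k /=.
  by congr (track S u); transp_tac.
- by rewrite IH1.
Qed.

Lemma nstrand_artin n u v : artin n u v -> nstrand n u = nstrand n v.
Proof.
rewrite /nstrand; elim=> {u v} [u v i e h|u v i j h h'|u v i h|u|u v _ IH|v u w _ IH1 _ IH2] //;
  rewrite ?all_cat /=.
- by rewrite !h.
- by rewrite h' (_ : i.+1 < n)//; lia.
- by rewrite h (_ : i.+1 < n)//; lia.
- by rewrite IH1.
Qed.

Lemma delete_artin n M u v S : nstrand n u -> artin n u v ->
  rank S n = M -> artin M (delete S u) (delete S v).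
Proof.
move=> hu huv; elim: huv S hu => {u v}
  [u v i e h|u v i j h h'|u v i h|u|u v uv IH|v u w uv IH1 _ IH2] S hu hS;
  last 3 first.
- exact: artin_refl.
- by apply: artin_sym; apply: IH; rewrite // (nstrand_artin uv).
- by apply: artin_trans (IH1 _ _ _) (IH2 _ _ _) => //; rewrite -(nstrand_artin uv).
all: rewrite !delete_cat.
all: have {hS} : rank (track S u) n = M
  by rewrite (rank_track _ (n := n))//; move: hu; rewrite /nstrand all_cat => /andP[].
all: move=> hS; apply: artin_cat; first exact: artin_refl.
all: move: (track S u) hS => T hT; move: {S hu} T hT => S hS.
- have -> : track S [:: (i, e); (i, ~~ e)] = S.
    by apply: funext => k /=; rewrite transpK.
  have t1 : transp i i = i.+1 by transp_tac.
  have t2 : transp i i.+1 = i by transp_tac.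
  rewrite /= t1 t2 andbC rank_transp_lo//; case: ifP => /andP; last first.
    by rewrite !cats0 /= => _; apply: artin_refl.
  case=> Si SSi; apply: (artin_free [::]).
  have := @rank_mono S _ _ h; rewrite !rankS Si SSi; lia.
- have -> : track S [:: (i, true); (j, true)] = track S [:: (j, true); (i, true)].
    by apply: funext => k /=; congr S; transp_tac.
  have t1 : transp i j = j by transp_tac.
  have t2 : transp i j.+1 = j.+1 by transp_tac.
  have t3 : transp j i = i by transp_tac.
  have t4 : transp j i.+1 = i.+1 by transp_tac.
  rewrite /= t1 t2 t3 t4 rank_transp_hi// (@rank_transp_lo _ j i); last by lia.
  case: (boolP (S i && S i.+1)) => [/andP[Si SSi]|_];
    case: (boolP (S j && S j.+1)) => [/andP[Sj SSj]|_]; try exact: artin_refl.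
  apply: (artin_far [::]).
    have := @rank_mono S _ _ h; rewrite !rankS Si SSi; lia.
  have := @rank_mono S _ _ h'; rewrite !rankS Sj SSj; lia.
- have -> : track S [:: (i.+1, true); (i, true); (i.+1, true)]
          = track S [:: (i, true); (i.+1, true); (i, true)].
    by apply: funext => k /=; congr S; transp_tac.
  have t0 : transp i i = i.+1 by transp_tac.
  have t1 : transp i i.+1 = i by transp_tac.
  have t2 : transp i i.+2 = i.+2 by transp_tac.
  have t3 : transp i.+1 i = i by transp_tac.
  have t4 : transp i.+1 i.+1 = i.+2 by transp_tac.
  have t5 : transp i.+1 i.+2 = i.+1 by transp_tac.
  have h1 : i.+1 < n by lia.
  have := @rank_mono S _ _ h; rewrite hS !rankS.
  rewrite /= !(t0, t1, t2, t3, t4, t5) !rankS /= !(rank_transp_lo, t0, t1, t2, t3, t4, t5) //.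
  case: (S i); case: (S i.+1); case: (S i.+2) => /=;
    rewrite ?addn0 ?addn1 => hM; try exact: artin_refl.
  by apply: (artin_braid [::]); lia.
Qed.

Lemma rank_ltn M n : rank (fun k => k < M) n = minn M n.
Proof.
by elim: n => [|n IH]; rewrite ?minn0// rankS IH; case: ltnP; lia.
Qed.

Lemma delete_delete S T S' w :
  (forall k, S k = T k && S' (rank T k)) -> delete S w = delete S' (delete T w).
Proof.
elim: w S T S' => //= -[i e] w IH S T S' H.
have rS : rank S i = rank S' (rank T i).
  elim: i {IH} => //= i IH; rewrite !rankS IH H.
  by case: (T i); rewrite ?addn0 // addn1 rankS.
have Ti := rankS T i.
case: (boolP (T i && T i.+1)) => [/andP[Ti0 Ti1]|Tn]; last first.
  have -> : S i && S i.+1 = false.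
    by apply: contraNF Tn => /andP[]; rewrite !H => /andP[-> _] /andP[-> _].
  apply: IH => k /=; rewrite H.
  case: (ltngtP k i) => ki; last 2 first.
  - case: (ltngtP k i.+1) => ki1; first lia.
      by rewrite rank_transp_hi//; congr (T _ && S' (rank T _)); transp_tac.
    subst k; have -> : transp i i.+1 = i by transp_tac.
    have -> : rank (T \o transp i) i.+1 = rank T i + T i.+1.
      by rewrite rankS rank_transp_lo//=; congr (_ + nat_of_bool (T _)); transp_tac.
    by case: (T i) Tn => //= /negbTE Tn; rewrite Tn addn0.
  - subst k; have -> : transp i i = i.+1 by transp_tac.
    rewrite rank_transp_lo// Ti; case: (T i) Tn => /= [/negbTE ->//|_].
    by rewrite addn0.
  have -> : transp i k = k by transp_tac.
  by rewrite rank_transp_lo// ltnW.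
rewrite /= !H Ti0 Ti1 Ti Ti0 addn1 rS; congr (_ ++ _).
apply: IH => k /=; rewrite H; case Tk: (T (transp i k)) => //=; congr (S' _).
move: Tk; case: (ltngtP k i) => ki; last 2 first.
- case: (ltngtP k i.+1) => ki1; first lia.
    have -> : transp i k = k by transp_tac.
    move=> _; rewrite rank_transp_hi//.
    have := @rank_mono T _ _ ki1; rewrite !rankS Ti0 Ti1 /= => h; transp_tac.
  subst k; have -> : transp i i.+1 = i by transp_tac.
  rewrite rankS rank_transp_lo//= => _.
  have -> : transp i i = i.+1 by transp_tac.
  rewrite Ti1; transp_tac.
- subst k; have -> : transp i i = i.+1 by transp_tac.
  rewrite rank_transp_lo// Ti Ti0 => _; transp_tac.
have -> : transp i k = k by transp_tac.
move=> Tk; rewrite rank_transp_lo; last exact: ltnW.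
have := @rank_mono T _ _ ki; rewrite rankS Tk /= => h; transp_tac.
Qed.

Lemma delete_id n w : nstrand n w -> delete (fun k => k < n) w = w.
Proof.
elim: w => //= -[i e] w IH /andP[/= h hw].
have -> : (fun k => k < n) \o transp i = (fun k => k < n).
  by apply: funext => k /=; transp_tac.
by rewrite IH// h (ltnW h) rank_ltn (minn_idPr _)//; lia.
Qed.

Lemma widen_inj n m (nm : n <= m) : injective (widen nm).
Proof.
move=> a b; rewrite -[a]bclass_repr -[b]bclass_repr !widen_bclass.
move/bclassP => /= h; apply/bclassP.
rewrite -(delete_id (valP (repr a))) -(delete_id (valP (repr b))).
apply: (delete_artin _ h); first exact: nstrand_widen nm (valP _).
by rewrite rank_ltn; apply/minn_idPl.
Qed.

Definition sbraid : choiceType := {n : nat & braid n}.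

Definition stable_eq (x y : sbraid) : bool :=
  `[< exists k (hx : tag x <= k) (hy : tag y <= k),
        widen hx (tagged x) = widen hy (tagged y) >].

Lemma stable_equiv : equiv_class_of stable_eq.
Proof.
split=> [x|x y|y x z].
- by apply/asboolP; exists (tag x), (leqnn _), (leqnn _).
- by apply/asboolP/asboolP => -[k [hx [hy h]]]; exists k, hy, hx.
- move=> /asboolP[k [hx [hy h]]] /asboolP[l [hy' [hz h']]]; apply/asboolP.
  have kl := leq_maxl k l; have lk := leq_maxr k l.
  exists (maxn k l), (leq_trans hx kl), (leq_trans hz lk).
  rewrite -(widen_comp hx kl) h (widen_comp hy kl (leq_trans hy kl)).
  rewrite -(widen_comp hz lk) -h' (widen_comp hy' lk (leq_trans hy' lk)).
  by congr widen; apply: bool_irrelevance.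
Qed.

Canonical stable_equivRel := EquivRelPack stable_equiv.

(* B_oo, the direct limit of the groups B_n under the maps widen *)
Definition Binf := {eq_quot stable_eq}.
HB.instance Definition _ : EqQuotient _ stable_eq Binf := EqQuotient.on Binf.
HB.instance Definition _ := Choice.on Binf.

Definition binj n (a : braid n) : Binf := \pi_Binf (Tagged braid a).

Lemma binjP n m (a : braid n) (b : braid m) :
  binj a = binj b <->
  exists k (hn : n <= k) (hm : m <= k), widen hn a = widen hm b.
Proof. by split=> [/eqquotP/asboolP|h]//; apply/eqquotP/asboolP. Qed.

Lemma binj_inj n : injective (@binj n).
Proof.
move=> a b /binjP[k [hn [hn' h]]]; apply: (@widen_inj _ _ hn).
by rewrite h; congr widen; apply: bool_irrelevance.
Qed.

Lemma binj_widen n m (nm : n <= m) a : binj (widen nm a) = binj a.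
Proof.
apply/binjP; exists m, (leqnn m), nm; exact: widen_comp.
Qed.

Lemma binj_surj (x : Binf) : exists n (a : braid n), x = binj a.
Proof.
exists (tag (repr x)), (tagged (repr x)); rewrite /binj taggedK.
by rewrite reprK.
Qed.

Definition imul (x y : Binf) : Binf :=
  binj (widen (leq_maxl (tag (repr x)) (tag (repr y))) (tagged (repr x))
      * widen (leq_maxr (tag (repr x)) (tag (repr y))) (tagged (repr y)))%g.

Definition ione : Binf := binj (1%g : braid 0).

Definition iinv (x : Binf) : Binf := binj ((tagged (repr x))^-1)%g.

Lemma repr_binj n (a : braid n) : exists k (hn : n <= k)
  (hk : tag (repr (binj a)) <= k), widen hk (tagged (repr (binj a))) = widen hn a.
Proof.
have /binjP[k [hk [hn h]]] : binj (tagged (repr (binj a))) = binj a.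
  by rewrite {1}/binj taggedK reprK.
by exists k, hn, hk.
Qed.

Lemma widen1 n m (nm : n <= m) : widen nm 1%g = 1%g.
Proof. by rewrite [1%g in LHS]/(1%g) /= /bone widen_bclass; apply/bclassP/artin_refl. Qed.

Lemma widenV n m (nm : n <= m) a : widen nm (a^-1)%g = ((widen nm a)^-1)%g.
Proof. by apply/esym/mulg1_eq; rewrite -widenM mulgV widen1. Qed.

Lemma binjM n (a b : braid n) : imul (binj a) (binj b) = binj (a * b)%g.
Proof.
have [k [ka [ka' ea]]] := repr_binj a; have [l [lb [lb' eb]]] := repr_binj b.
rewrite /imul; set x := repr (binj a) in ka' ea *; set y := repr (binj b) in lb' eb *.
have hm : maxn (tag x) (tag y) <= maxn k l by rewrite geq_max !leq_max ka' lb' orbT.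
rewrite -(binj_widen hm) widenM -(binj_widen (leq_trans ka (leq_maxl k l))) widenM.
congr (binj (_ * _))%g.
  rewrite (widen_comp _ _ (leq_trans ka' (leq_maxl k l))).
  by rewrite -(widen_comp ka' (leq_maxl k l)) ea; apply: widen_comp.
rewrite (widen_comp _ _ (leq_trans lb' (leq_maxr k l))).
by rewrite -(widen_comp lb' (leq_maxr k l)) eb; apply: widen_comp.
Qed.

Lemma binjV n (a : braid n) : iinv (binj a) = binj (a^-1)%g.
Proof.
have [k [ka [ka' ea]]] := repr_binj a.
by rewrite /iinv -(binj_widen ka') widenV ea -widenV binj_widen.
Qed.

Lemma binj1 n : binj (1%g : braid n) = ione.
Proof. by rewrite /ione -(binj_widen (leq0n n)) widen1. Qed.

Lemma binj_surj2 (x y : Binf) : exists n (a b : braid n), x = binj a /\ y = binj b.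
Proof.
have [n [a ->]] := binj_surj x; have [m [b ->]] := binj_surj y.
exists (maxn n m), (widen (leq_maxl n m) a), (widen (leq_maxr n m) b).
by rewrite !binj_widen.
Qed.

Lemma imulA : associative imul.
Proof.
move=> x y z; have [n [a [b [-> ->]]]] := binj_surj2 x y.
have [m [c ->]] := binj_surj z.
rewrite -(binj_widen (leq_maxr n m) c) -(binj_widen (leq_maxl n m) a).
by rewrite -(binj_widen (leq_maxl n m) b) !binjM mulgA.
Qed.

Lemma i1mul : left_id ione imul.
Proof. by move=> x; have [n [a ->]] := binj_surj x; rewrite -(binj1 n) binjM mul1g. Qed.

Lemma imul1 : right_id ione imul.
Proof. by move=> x; have [n [a ->]] := binj_surj x; rewrite -(binj1 n) binjM mulg1. Qed.

Lemma iVmul : left_inverse ione iinv imul.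
Proof.
by move=> x; have [n [a ->]] := binj_surj x; rewrite binjV binjM mulVg binj1.
Qed.

Lemma imulV : right_inverse ione iinv imul.
Proof.
by move=> x; have [n [a ->]] := binj_surj x; rewrite binjV binjM mulgV binj1.
Qed.

HB.instance Definition _ := isGroup.Build Binf imulA i1mul imul1 iVmul imulV.

(* final position of the strand of a starting at position i *)
Definition strand_endb n (a : braid n) (i : nat) : nat :=
  strand_end (val (repr a)) i.

Lemma nstrand_first M n (Mn : M <= n) (w : bword n) :
  nstrand M (delete (fun k => k < M) (val w)).
Proof. by apply: nstrand_delete (valP w) _; rewrite rank_ltn; apply/minn_idPl. Qed.

(* the M-strand braid formed by the strands of a starting at positions < M *)
Definition first_strands M n (Mn : M <= n) (a : braid n) : braid M :=
  bclass (Sub _ (nstrand_first Mn (repr a))).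

Definition first_trivial M n (Mn : M <= n) (a : braid n) : Prop :=
  (forall i, i < M -> strand_endb a i = i) /\ first_strands Mn a = 1%g.

Local Open Scope classical_set_scope.

(* The first M strands of b are trivial. This may be tested on any            *)
(* representative of b with at least M strands (lemma UP).                    *)
Definition U (M : nat) : set Binf :=
  [set b | exists n (Mn : M <= n) (a : braid n), b = binj a /\ first_trivial Mn a].

Definition wtrivial M (w : word) : Prop :=
  (forall i, i < M -> strand_end w i = i) /\
  artin M (delete (fun k => k < M) w) [::].

Lemma wtrivial_artin M n u v : nstrand n u -> artin n u v -> M <= n ->
  wtrivial M u -> wtrivial M v.
Proof.
move=> hu huv Mn [h1 h2]; split=> [i iM|].
  by rewrite -(strand_end_artin i huv); apply: h1.
apply: artin_trans h2; apply/artin_sym/(delete_artin hu huv).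
by rewrite rank_ltn; apply/minn_idPl.
Qed.

Lemma first_trivialP M n (Mn : M <= n) (w : bword n) :
  first_trivial Mn (bclass w) <-> wtrivial M (val w).
Proof.
have h := repr_bclass w; split=> [[h1 /bclassP h2]|].
  by apply: (wtrivial_artin (valP _) h Mn); split.
move=> /(wtrivial_artin (valP _) (artin_sym h) Mn)[h1 h2].
by split=> //; apply/bclassP.
Qed.

Lemma UP M n (w : bword n) : U M (binj (bclass w)) <-> wtrivial M (val w).
Proof.
split=> [[m [Mm [a [/binjP[k [nk [mk h]]] ta]]]]|h].
  move: h ta; rewrite -[a]bclass_repr !widen_bclass => /bclassP/= h.
  move=> /first_trivialP; apply: wtrivial_artin (artin_sym h) (leq_trans Mm mk).
  exact: nstrand_widen mk (valP _).
exists (maxn M n), (leq_maxl M n), (widen (leq_maxr M n) (bclass w)).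
by rewrite binj_widen; split=> //; rewrite widen_bclass; apply/first_trivialP.
Qed.

Lemma Binf_word (x : Binf) : exists n (w : bword n), x = binj (bclass w).
Proof.
by have [n [a ->]] := binj_surj x; exists n, (repr a); rewrite bclass_repr.
Qed.

Lemma U1 M : U M 1%g.
Proof. by apply/(@UP M 0 (Sub [::] isT)); split=> //; apply: artin_refl. Qed.

Lemma U_antimono M N : M <= N -> U N `<=` U M.
Proof.
move=> MN b; have [n [w ->]] := Binf_word b => /UP[h1 h2]; apply/UP; split.
  by move=> i iM; apply: h1; lia.
have hS k : (k < M) = (k < N) && (rank (fun k => k < N) k < M).
  by rewrite rank_ltn; lia.
rewrite (@delete_delete (fun k => k < M) (fun k => k < N) (fun k => k < M) _ hS); apply: (@delete_artin N _ _ [::]) => //.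
- by apply: (@nstrand_delete _ (maxn n N) N);
    [apply: nstrand_widen (valP w); lia | rewrite rank_ltn; lia].
- by rewrite rank_ltn; lia.
Qed.

Lemma strand_end_inv w : cancel (strand_end w) (strand_end (winv w)).
Proof.
elim: w => // -[i e] w IH k; rewrite /winv /= rev_cons -cats1 strand_end_cat /=.
by rewrite [X in transp i X]IH transpK.
Qed.

Lemma trackE S w k : track S w k = S (strand_end (winv w) k).
Proof.
elim: w S k => // -[i e] w IH S k.
by rewrite /= IH /winv /= rev_cons -cats1 strand_end_cat.
Qed.

Lemma track_fix M w : (forall i, i < M -> strand_end w i = i) ->
  track (fun k => k < M) w = (fun k => k < M).
Proof.
move=> h; apply: funext => k; rewrite trackE.
case: (ltnP k M) => [kM|Mk]; first by rewrite -{1}(h k kM) strand_end_inv.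
apply/negbTE/negP => jM; have := strand_end_inv (winv w) k; rewrite winvK h// => kE.
by move: jM; rewrite kE ltnNge Mk.
Qed.

Lemma transp_first n i : i.+1 < n -> (fun k => k < n) \o transp i = (fun k => k < n).
Proof. by move=> h; apply: funext => k /=; transp_tac. Qed.

Lemma track_nstrand n w : nstrand n w ->
  track (fun k => k < n) w = (fun k => k < n).
Proof. by elim: w => //= -[i e] w IH /andP[/= h hw]; rewrite transp_first// IH. Qed.

Lemma strand_end_nstrand n w k : nstrand n w -> k < n -> strand_end w k < n.
Proof.
elim: w k => //= -[i e] w IH k /andP[/= h hw] kn; apply: IH => //; transp_tac.
Qed.

Lemma UM M a b : U M a -> U M b -> U M (a * b)%g.
Proof.
have [n [x [y [-> ->]]]] := binj_surj2 a b.
rewrite -[x]bclass_repr -[y]bclass_repr => /UP[h1 h2] /UP[h3 h4].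
rewrite [X in U M X]binjM -(bclassM (nstrand_cat _ _)); apply/UP; split=> /=.
  by move=> i iM; rewrite strand_end_cat h1// h3.
by rewrite delete_cat track_fix//; apply: (artin_cat h2 h4).
Qed.

Lemma UV M a : U M a -> U M (a^-1)%g.
Proof.
have [n [w ->]] := Binf_word a; move=> /UP[h1 h2].
rewrite [X in U M X]binjV -(bclassV (nstrand_inv w)).
have hV i : i < M -> strand_end (winv (val w)) i = i.
  by move=> iM; rewrite -{1}(h1 i iM) strand_end_inv.
apply/UP; split => //=.
apply: (@artin_trans _ (delete (fun k => k < M) (val w ++ winv (val w)))).
  rewrite delete_cat track_fix// -{1}[delete _ (winv _)]cat0s.
  by apply: artin_cat; [exact: artin_sym|exact: artin_refl].
apply: (@delete_artin (maxn n M) _ _ [::]).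
- apply: (@nstrand_widen n); first lia.
  by rewrite /nstrand all_cat; apply/andP; split; [exact: valP|exact: nstrand_inv].
- by apply: artin_widen (artin_mulV (valP w)); lia.
- by rewrite rank_ltn; lia.
Qed.

Lemma UJ (b : Binf) : exists n, forall N, n <= N ->
  forall u, U N u -> U N (b * u * b^-1)%g.
Proof.
have [n [w ->]] := Binf_word b; exists n => N nN u.
have [m [v ->]] := Binf_word u => /UP[h1 h2].
pose k := maxn N m; have Nk : N <= k by lia.
have mk : m <= k by lia.
have nk := leq_trans nN Nk.
have hw := nstrand_widen nN (valP w).
rewrite -(binj_widen nk) -(binj_widen mk) !widen_bclass.
rewrite [X in (_ * X)%g]binjV [X in (X * _)%g]binjM [X in U N X]binjM.
rewrite -(bclassV (nstrand_inv _)) -(bclassM (nstrand_cat _ _)).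
rewrite -(bclassM (nstrand_cat _ _)).
apply/UP => /=; split=> [i iN|].
  by rewrite !strand_end_cat h1 ?strand_end_inv// strand_end_nstrand.
rewrite !delete_cat !track_cat !(track_nstrand hw) track_fix// (delete_id hw).
rewrite (@delete_id _ (winv (val w))) ?nstrand_winv//.
apply: artin_trans (artin_mulV hw).
apply: artin_cat; last exact: artin_refl.
rewrite -[X in artin _ _ X]cats0.
by apply: artin_cat; [exact: artin_refl|].
Qed.

(* Group topology having the sets U M as a neighborhood basis at 1; see       *)
(* Binf_mul_continuous, Binf_inv_continuous and Binf_cvg1.                    *)
Definition Binf_nbhs (b : Binf) : set_system Binf :=
  [set A | exists M, forall u, U M u -> A (b * u)%g].

HB.instance Definition _ := hasNbhs.Build Binf Binf_nbhs.

Lemma Binf_nbhs_filter (b : Binf) : ProperFilter (nbhs b).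
Proof.
split; first by move=> [M] /(_ 1%g (U1 M)).
split; first by exists 0.
- move=> A B [M hA] [N hB]; exists (maxn M N) => u hu; split.
    by apply: hA; apply: U_antimono hu; lia.
  by apply: hB; apply: U_antimono hu; lia.
- by move=> A B AB [M hA]; exists M => u /hA /AB.
Qed.

Lemma Binf_nbhs_singleton (b : Binf) A : nbhs b A -> A b.
Proof. by move=> [M /(_ 1%g (U1 M))]; rewrite mulg1. Qed.

Lemma Binf_nbhs_nbhs (b : Binf) A : nbhs b A -> nbhs b (nbhs^~ A).
Proof.
by move=> [M hA]; exists M => u hu; exists M => v hv; rewrite -mulgA; apply/hA/UM.
Qed.

HB.instance Definition _ := Nbhs_isNbhsTopological.Build Binf
  Binf_nbhs_filter Binf_nbhs_singleton Binf_nbhs_nbhs.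

Lemma Binf_mul_continuous :
  continuous (fun x : Binf * Binf => (x.1 * x.2)%g : Binf).
Proof.
move=> [a b] A [M hA] /=; have [n hn] := UJ (b^-1)%g.
pose N := maxn M n.
exists ([set (a * u)%g | u in U N], [set (b * u)%g | u in U N]) => /=.
  by split; exists N => u uN; exists u.
move=> [x y] /= [[u uN <-] [v vN <-]].
have -> : (a * u * (b * v) = a * b * ((b^-1 * u * b^-1^-1) * v))%g.
  by rewrite invgK !mulgA mulgK.
apply: hA; apply: U_antimono (UM (hn N _ u uN) vN); rewrite /N; lia.
Qed.

Lemma Binf_inv_continuous : continuous (fun x : Binf => (x^-1)%g : Binf).
Proof.
move=> b A [M hA]; have [n hn] := UJ b.
exists (maxn M n) => u uN /=.
have -> : ((b * u)^-1 = b^-1 * (b * u^-1 * b^-1))%g by rewrite invgM !mulgA mulVg mul1g.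
apply: hA; apply: U_antimono (hn _ _ _ (UV uN)); lia.
Qed.

Lemma Binf_cvg1 (u : nat -> Binf) :
  u @ \oo --> (1%g : Binf) <->
  forall M, exists N, forall n, N <= n -> U M (u n).
Proof.
split=> [h M|h A [M hA]].
  have : nbhs (1%g : Binf) (U M) by exists M => v; rewrite mul1g.
  by move=> /h[N _ hN]; exists N => n /hN.
have [N hN] := h M; exists N => // n /hN un /=.
by have := hA _ un; rewrite mul1g.
Qed.

Record distance (R : numFieldType) (T : Type) := Distance {
  dist :> T -> T -> R;
  distxx : forall x, dist x x = 0%R;
  dist_positivity : forall x y, dist x y = 0%R -> x = y;
  dist_sym : forall x y, dist x y = dist y x;
  dist_triangle : forall y x z, (dist x z <= dist x y + dist y z)%R }.

(* T with the metric structure given by d, regardless of any topology on T *)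
Definition metrized (R : numFieldType) (T : choiceType) (d : distance R T) : Type := T.
HB.instance Definition _ R T d := Choice.on (@metrized R T d).
HB.instance Definition _ (R : numFieldType) (T : choiceType) (d : distance R T) :=
  isMetric.Build R (@metrized R T d)
    (distxx d) (@dist_positivity R T d) (dist_sym d) (dist_triangle d).

Definition complete_distance (R : realType) (T : choiceType) (d : distance R T) :=
  forall u : nat -> metrized d,
    cauchy (u @ \oo) -> exists l : metrized d, u @ \oo --> l.

Definition induces_topology (R : realType) (T : topologicalType) (d : distance R T) :=
  forall A : set T, open A <-> open (A : set (metrized d)).

(* Main.v *)
Require Import Defs.
From mathcomp Require Import all_boot all_order all_algebra.
From mathcomp Require Import boolp classical_sets reals topology.
From mathcomp Require Import lra zify.

Set Implicit Arguments.
Unset Strict Implicit.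
Unset Printing Implicit Defensive.

Import Order.TTheory GRing.Theory Num.Theory.

(* Every U_M contains sigma_M, so no point of the group is isolated; but the  *)
(* group is countable, and by Baire's argument (nested balls avoiding the     *)
(* points one after the other) a nonempty countable complete metric space has *)
(* an isolated point.                                                         *)

(** A complete metric inducing the topology would turn the countable group ([Binf_countable]) into a
    space covered by [countable_complete_isolated], hence with an open singleton. By translation
    this forces some [U M] to be trivial ([Binf_not_isolated]), against [U_nontrivial]. *)

Section CountableBaire.
Local Open Scope ring_scope.
Local Open Scope classical_set_scope.
Variables (R : realType) (T : metricType R).

(** One step of the Baire construction: since [x] is not isolated, the ball of radius [r / 2] about
    it has a point [y] other than [z]. The ball of radius [s] about [y] stays within distance [r] of
    [x], and [z] lies at twice the radius [s] from [y]. *)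
Lemma avoiding_ball (x z : T) (r : R) :
  ~ open [set x] -> 0 < r ->
  exists y s, [/\ 0 < s, s *+ 2 <= r, mdist x y + s <= r & s *+ 2 <= mdist y z].
Proof.
move=> nx r0; have r20 : 0 < r / 2 by rewrite divr_gt0.
have [y [xy yz]] : exists y, mdist x y < r / 2 /\ y <> z.
  apply: contrapT => h; apply: nx.
  have xz y : mdist x y < r / 2 -> y = z.
    by move=> xy; apply: contrapT => yz; apply: h; exists y.
  rewrite openE => _ ->; rewrite /interior; apply: filterS (nbhsx_ballx x _ r20).
  rewrite ballEmdist => y /xz -> /=; apply/esym/xz; by rewrite mdistxx.
have yz0 : 0 < mdist y z by rewrite mdist_gt0; apply/eqP.
set s := Num.min (r / 2) (mdist y z / 2).
have s1 : s <= r / 2 by rewrite ge_min lexx.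
have s2 : s <= mdist y z / 2 by rewrite ge_min lexx orbT.
exists y, s; split; [|lra..].
by rewrite lt_min r20 divr_gt0.
Qed.

Lemma countable_complete_isolated (e : nat -> T) :
  (forall x, exists n, e n = x) ->
  (forall u : nat -> T, cauchy (u @ \oo) -> exists l : T, u @ \oo --> l) ->
  exists x : T, open [set x].
Proof.
move=> e_surj cT; apply: contrapT => /forallNP niso.
have [f fP] : {f : nat * (T * R) -> T * R & forall p, 0 < p.2.2 ->
    [/\ 0 < (f p).2, (f p).2 *+ 2 <= p.2.2, mdist p.2.1 (f p).1 + (f p).2 <= p.2.2
      & (f p).2 *+ 2 <= mdist (f p).1 (e p.1)]}.
  apply: (@choice _ _ (fun p q => 0 < p.2.2 -> [/\ 0 < q.2, q.2 *+ 2 <= p.2.2,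
    mdist p.2.1 q.1 + q.2 <= p.2.2 & q.2 *+ 2 <= mdist q.1 (e p.1)])).
  (* For a nonpositive radius the requirement is vacuous and any value will do. *)
  move=> [k [x r]] /=; have [r0|_] := ltP 0 r; last by exists (x, r).
  by have [y [s h]] := avoiding_ball (e k) (niso x) r0; exists (y, s).
pose s := nat_rect _ (e 0%N, 1 : R) (fun k p => f (k, p)).
pose x k := (s k).1; pose r k := (s k).2.
have r_gt0 k : 0 < r k by elim: k => [|k /(fP (k, s k))[]] /=; first exact: ltr01.
have sP k : [/\ r k.+1 *+ 2 <= r k, mdist (x k) (x k.+1) + r k.+1 <= r k
               & r k.+1 *+ 2 <= mdist (x k.+1) (e k)].
  by have [] := fP (k, s k) (r_gt0 k).
(* Halving gives geometric decay; this weaker bound suffices for [r k] to tend to 0. *)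
have r_small k : r k * k.+1%:R <= 1.
  elim: k => [|k IH]; first by rewrite mulr1.
  have [h _ _] := sP k; apply: le_trans IH.
  have := r_gt0 k.+1; have : (0 : R) <= k%:R by rewrite ler0n.
  by rewrite -!natr1; nra.
have nested k n : (k <= n)%N -> mdist (x k) (x n) < r k.
  move=> /subnKC <-; suff : mdist (x k) (x (k + (n - k))%N) + r (k + (n - k))%N <= r k.
    by have := r_gt0 (k + (n - k))%N; lra.
  elim: (n - k)%N => [|j IH]; first by rewrite addn0 mdistxx add0r.
  rewrite addnS; have [_ h _] := sP (k + j)%N.
  by have := metric_triangle (x k) (x (k + j)%N) (x (k + j).+1); lra.
have [l xl] : exists l : T, x @ \oo --> l.
  apply/cT/cauchy_exP => eps eps0.
  have [k hk] : exists k, r k < eps.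
    exists (Num.truncn eps^-1); have := r_small (Num.truncn eps^-1).
    have := truncnS_gt eps^-1.
    have := r_gt0 (Num.truncn eps^-1); set q := _.+1%:R.
    move=> r0 h1 h2; have : 1 < q * eps by rewrite -ltr_pdivrMr// div1r.
    by nra.
  exists (x k); exists k => // n /= kn; rewrite ballEmdist /=.
  exact: lt_trans (nested _ _ kn) hk.
(* The limit is some [e k], at distance at least [2 * r k.+1] from [x k.+1]; yet a late [x n] is
   within [r k.+1] of both, a contradiction. *)
have [k kl] := e_surj l; have [_ _ h] := sP k.
have [N _ hN] := cvg_ball xl (r_gt0 k.+1).
have := hN (maxn N k.+1) (leq_maxl _ _); rewrite ballEmdist /= metric_sym => h1.
have := nested _ _ (leq_maxr N k.+1) => h2.
move: h; rewrite kl; have := metric_triangle (x k.+1) (x (maxn N k.+1)) l.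
by lra.
Qed.

End CountableBaire.

Lemma word_nstrand (w : word) : exists n, nstrand n w.
Proof.
elim: w => [|[i e] w [n hw]]; first by exists 0.
exists (maxn n i.+2); rewrite /nstrand /= leq_maxr /=.
exact: nstrand_widen (leq_maxl _ _) hw.
Qed.

(** Braid words are countably many, and the class of a word in the direct limit does not depend on
    the number of strands chosen for it. *)
Lemma Binf_countable : exists e : nat -> Binf, forall x, exists n, e n = x.
Proof.
have [f fP] : {f : word -> Binf & forall w,
    exists n (hw : nstrand n w), f w = binj (bclass (Sub w hw))}.
  apply: (@choice _ _ (fun w b => exists n (hw : nstrand n w),
    b = binj (bclass (Sub w hw)))) => w.
  have [n hw] := word_nstrand w.
  by exists (binj (bclass (Sub w hw))), n, hw.
exists (fun n => if unpickle n is Some w then f w else 1%g) => x.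
have [n [w ->]] := Binf_word x; exists (pickle (val w)); rewrite pickleK.
have [m [hw ->]] := fP (val w); apply/binjP.
exists (maxn m n), (leq_maxl m n), (leq_maxr m n).
by rewrite !widen_bclass; apply/bclassP; apply: artin_refl.
Qed.

(** The generator [(M, true)] crosses strands [M] and [M.+1], beyond the first [M] as numbering
    starts at 0; its permutation shows that it is nontrivial. *)
Lemma U_nontrivial M : exists2 b, U M b & b <> 1%g.
Proof.
have h : nstrand M.+2 [:: (M, true)] by rewrite /nstrand /= ltnSn.
exists (binj (bclass (Sub [:: (M, true)] h : bword M.+2))).
  apply/UP; split=> [i iM /=|/=].
    by rewrite /transp; case: (i =P M) => [|_]; case: (i =P M.+1) => [|_]; lia.
  by rewrite ltnn /=; apply: artin_refl.
rewrite [1%g](_ : _ = binj (bclass (Sub [::] isT : bword M.+2))); last first.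
  by rewrite -[LHS](binj1 M.+2).
move/binj_inj/bclassP/strand_end_artin => /(_ M) /=.
by rewrite /transp eqxx; lia.
Qed.

Lemma Binf_not_isolated (b : Binf) : ~ open [set b]%classic.
Proof.
(* If the singleton were open, [b * u = b] for all [u] in [U M]. *)
rewrite openE => /(_ b erefl)[M bU].
have [u /bU /= bu u1] := U_nontrivial M; apply: u1.
by apply: (@mulgI _ b); rewrite bu mulg1.
Qed.

Theorem lemma6 (R : realType) :
  ~ exists d : distance R Binf, induces_topology d /\ complete_distance d.
Proof.
move=> [d [dT dC]]; have [e e_surj] := Binf_countable.
have [b] := @countable_complete_isolated R (metrized d) e e_surj dC.
by move/(dT [set b]%classic).2; apply: Binf_not_isolated.
Qed.
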